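(* Let $\sigma^2>0$, and let $S\sim\mu$ with $\mu$ a probability law on $[0,\infty)$ such that $m_1:=\mathbb E[S]>0$ and $m_2:=\mathbb E[S^2]<\infty$. Then, as $\omega\downarrow0$, $$L_\mu(\omega)=\frac{\sigma^2}{m_1}+\frac{\operatorname{Var}(S)}{m_1^2}\,\omega+o(\omega).$$ In particular, $L_\mu'(0+)=\dfrac{\operatorname{Var}(S)}{\mathbb E[S]^2}$.
   Context: For $\omega>0$, $L_\mu(\omega)=\mathbb E_\mu\big[\frac{\sigma^2\omega}{\sigma^2+\omega S}\big]\big/\mathbb E_\mu\big[\frac{\omega S}{\sigma^2+\omega S}\big]$, extended by $L_\mu(0)=\lim_{\omega\downarrow0}L_\mu(\omega)=\sigma^2/\mathbb E_\mu[S]$. $L_\mu'(0+)$ denotes the right derivative at $0$. *)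

(* Defs.v *)
From HB Require Import structures.
From mathcomp Require Import all_boot all_order all_algebra.
From mathcomp Require Import all_classical all_reals all_analysis.
Set Implicit Arguments.
Unset Strict Implicit.
Unset Printing Implicit Defensive.
Import Order.TTheory GRing.Theory Num.Theory.
Import numFieldNormedType.Exports.
Local Open Scope classical_set_scope.
Local Open Scope ring_scope.

Definition Lratio (R : realType) (sigma : R)
    (mu : probability R R) (omega : R) : R :=
  fine ('E_mu[fun s : R => (sigma ^+ 2 * omega / (sigma ^+ 2 + omega * s))%R])%E
  / fine ('E_mu[fun s : R => (omega * s / (sigma ^+ 2 + omega * s))%R])%E.

(* Only [0 <= omega] is meaningful; the value at a negative omega is junk. *)
Definition L (R : realType) (sigma : R)
    (mu : probability R R) (omega : R) : R :=
  if omega == 0 then lim (Lratio sigma mu w @[w --> 0^'+])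
  else Lratio sigma mu omega.

Definition has_right_derivative (R : realType) (f : R -> R) (a l : R) : Prop :=
  (f (a + h) - f a) / h @[h --> 0^'+] --> l.

Definition has_law d (Omega : measurableType d) (R : realType)
    (P : probability Omega R) (S : {RV P >-> R})
    (mu : probability R R) : Prop :=
  forall A : set R, measurable A -> distribution P S A = mu A.

(* Main.v *)
Require Import Defs.
From HB Require Import structures.
From mathcomp Require Import all_boot all_order all_algebra.
From mathcomp Require Import all_classical all_reals all_analysis.
From mathcomp Require Import measurable_realfun ring.
Import Order.TTheory GRing.Theory Num.Theory.
Import numFieldNormedType.Exports.
Local Open Scope classical_set_scope.
Local Open Scope ring_scope.

(** Write c = sigma^2, B(w) = E[S/(c + w S)] and Q(w) = E[S^2/(c + w S)].
    Linearity gives E[c/(c + w S)] = 1 - w B(w) and c B(w) = m1 - w Q(w), hence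
    L(w) = 1/B(w) - w = c/(m1 - w Q(w)) - w and
    (L(w) - c/m1)/w = c Q(w) / (m1 (m1 - w Q(w))) - 1.
    Dominated convergence (with dominating function S^2/c) gives Q(w) -> m2/c,
    so the quotient tends to m2/m1^2 - 1 = Var(S)/m1^2. *)

(** * Measurability of quotients and square integrability *)

Lemma measurable_invr (R : realType) :
  measurable_fun [set: R] (GRing.inv : R -> R).
Proof.
(* Inversion, with [0^-1 = 0], is discontinuous only at 0; a singleton is harmless, and on its open
   complement continuity suffices. *)
have -> : [set: R] = [set 0] `|` ~` [set 0] by rewrite setUv.
apply/measurable_funU; [by []|exact: measurableC|split].
  exact: measurable_fun_set1.
apply: open_continuous_measurable_fun.
  by apply: closed_openC; exact: closed_eq.
by move=> x /[!inE] /eqP x0; exact: inv_continuous.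
Qed.

Lemma measurable_fun_divr d (T : measurableType d) (R : realType)
    (f g : T -> R) :
  measurable_fun setT f -> measurable_fun setT g ->
  measurable_fun setT (fun x => f x / g x).
Proof.
move=> mf mg; apply: measurable_funM => //.
by apply: measurableT_comp => //; exact: measurable_invr.
Qed.

Lemma Lfun2_expectation_sqr d (T : measurableType d) (R : realType)
    (P : probability T R) (X : T -> R) :
  measurable_fun setT X -> ('E_P[fun x => (X x ^+ 2)%R] < +oo)%E ->
  X \in Lfun P 2%:E.
Proof.
move=> mX X2; rewrite inE; apply/andP; split; rewrite inE//=.
rewrite /finite_norm unlock poweR_lty//.
under eq_integral => x _ do rewrite /= powR_mulrn// real_normK ?num_real//.
by move: X2; rewrite unlock.
Qed.

(** * The ratio of expectations for an everywhere nonnegative variable *)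

Section ratio_asymptotics.
Context d (T : measurableType d) (R : realType) (P : probability T R).
Variables (X : T -> R) (c : R).
Hypotheses (mX : measurable_fun setT X) (X0 : forall x, 0 <= X x).
Hypotheses (c0 : 0 < c) (X2 : P.-integrable setT (EFin \o (fun x => X x ^+ 2))).
Hypotheses (X1 : P.-integrable setT (EFin \o X)).

Let m1 := \int[P]_x X x.
Let m2 := \int[P]_x (X x ^+ 2).
Let B w := \int[P]_x (X x / (c + w * X x)).
Let Q w := \int[P]_x (X x ^+ 2 / (c + w * X x)).

Let den_gt0 (w : R) x : 0 <= w -> 0 < c + w * X x.
Proof. by move=> w0; rewrite ltr_wpDr// mulr_ge0. Qed.

Let measurable_ratio (f : T -> R) w : measurable_fun setT f ->
  measurable_fun setT (fun x => f x / (c + w * X x)).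
Proof.
move=> mf; apply: measurable_fun_divr => //.
by apply: measurable_funD => //; exact: measurable_funM.
Qed.

(** The denominator is at least [c]. The bound does not depend on [w], so it also serves as the
    dominating function. *)
Let ratio_le (y w : R) x : 0 <= w -> 0 <= y -> y / (c + w * X x) <= c^-1 * y.
Proof.
move=> w0 y0; rewrite mulrC ler_wpM2r// lef_pV2 ?posrE ?den_gt0//.
by rewrite lerDl mulr_ge0.
Qed.

Let integrable_ratio (f : T -> R) (w : R) : 0 <= w -> (forall x, 0 <= f x) ->
  P.-integrable setT (EFin \o f) ->
  P.-integrable setT (EFin \o (fun x => f x / (c + w * X x))).
Proof.
move=> w0 f0 intf; have mf : measurable_fun setT f.
  exact/measurable_EFinP/(measurable_int _ intf).
apply: (le_integrable measurableT _ _ (integrableZl measurableT c^-1 intf)).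
  exact/measurable_EFinP/measurable_ratio.
move=> x _ /=; rewrite lee_fin !ger0_norm.
- exact: ratio_le.
- by rewrite mulr_ge0// invr_ge0 ltW.
- by rewrite divr_ge0// ltW// den_gt0.
Qed.

(** Integrate the pointwise identity [c * x / (c + w * x) = x - w * (x ^+ 2 / (c + w * x))]. *)
Let B_Q (w : R) : 0 <= w -> c * B w = m1 - w * Q w.
Proof.
move=> w0; have iB := integrable_ratio _ _ w0 X0 X1.
have iQ := integrable_ratio _ _ w0 (fun x => sqr_ge0 _) X2.
rewrite -!RintegralZl// -RintegralB//; last exact: (integrableZl _ w iQ).
apply: eq_Rintegral => x _ /=; have := lt0r_neq0 (den_gt0 w x w0).
by move=> den_neq0; field.
Qed.

(** Integrate [c * w / (c + w * x) = w * (1 - w * (x / (c + w * x)))]; the constant 1 integrates to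
    1 under a probability. *)
Let num_B (w : R) : 0 <= w ->
  \int[P]_x (c * w / (c + w * X x)) = w * (1 - w * B w).
Proof.
move=> w0; have iB := integrable_ratio _ _ w0 X0 X1.
have wB : P.-integrable setT (EFin \o (fun x => w * (X x / (c + w * X x)))).
  exact: (integrableZl _ w iB).
have i1 : P.-integrable setT (EFin \o (fun=> 1 : R)).
  exact: finite_measure_integrable_cst.
have <- : \int[P]_x (1 - w * (X x / (c + w * X x))) = 1 - w * B w.
  rewrite RintegralB// RintegralZl// Rintegral_cst//.
  by rewrite [X in fine X]probability_setT mul1r.
rewrite -RintegralZl//; last exact: (integrableB _ i1 wB).
apply: eq_Rintegral => x _ /=; have := lt0r_neq0 (den_gt0 w x w0).
by move=> den_neq0; field.
Qed.

Let den_B (w : R) : 0 <= w -> \int[P]_x (w * X x / (c + w * X x)) = w * B w.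
Proof.
move=> w0; rewrite -RintegralZl//; last exact: integrable_ratio.
by apply: eq_Rintegral => x _; rewrite mulrA.
Qed.

Let cvg_Q : Q w @[w --> 0^'+] --> m2 / c.
Proof.
(* Dominated convergence concerns sequences, so the limit is tested along positive [u n] tending to
   0. *)
apply/cvg_at_rightP => u [u0 ul].
have mX2 : measurable_fun setT (fun x => X x ^+ 2) by exact: measurable_funX.
have ig : P.-integrable setT (EFin \o (fun x => c^-1 * X x ^+ 2)).
  exact: (integrableZl _ c^-1 X2).
have mg := measurable_int _ ig.
pose F n := EFin \o (fun x => X x ^+ 2 / (c + u n * X x)).
pose G := EFin \o (fun x => c^-1 * X x ^+ 2).
have mF n : measurable_fun setT (F n).
  exact/measurable_EFinP/measurable_ratio.
have F_cvg : \forall x \ae P, setT x -> F n x @[n --> \oo] --> G x.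
  apply: aeW => x _; apply: cvg_EFin; first exact: nearW.
  rewrite /comp /= mulrC; apply: cvgM; first exact: cvg_cst.
  apply: cvgV; first exact: lt0r_neq0.
  rewrite -[X in _ --> X]addr0 -(mul0r (X x)).
  by apply: cvgD; [exact: cvg_cst|apply: cvgM => //; exact: cvg_cst].
have F_le : \forall x \ae P, forall n, setT x -> (`|F n x| <= G x)%E.
  apply: aeW => x n _ /=; rewrite lee_fin ger0_norm.
    by rewrite ratio_le ?sqr_ge0// ltW.
  by rewrite divr_ge0 ?sqr_ge0// ltW// den_gt0// ltW.
have [ig' _] := dominated_convergence measurableT mF mg F_cvg ig F_le.
move=> Ql; rewrite mulrC -RintegralZl//.
apply: fine_cvg; rewrite fineK//.
exact: integrable_fin_num.
Qed.

Lemma ratio_expansion : 0 < m1 ->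
  (\int[P]_x (c * w / (c + w * X x)) / \int[P]_x (w * X x / (c + w * X x))
     - c / m1) / w @[w --> 0^'+] --> (m2 - m1 ^+ 2) / m1 ^+ 2.
Proof.
move=> m10; have id0 : (w : R) @[w --> 0^'+] --> (0 : R).
  exact: cvg_at_right_filter.
have cB : m1 - w * Q w @[w --> 0^'+] --> m1.
  have := cvgM id0 cvg_Q; rewrite mul0r => wQ.
  rewrite -[X in _ --> X]subr0; apply: cvgB; [exact: cvg_cst|exact: wQ].
have m1n0 := lt0r_neq0 m10; have cn0 := lt0r_neq0 c0.
(* For small [w > 0], [m1 - w * Q w] is positive by [cB], so the factor [w] and all denominators
   cancel to this closed form, whose limit can be read off. *)
suff H : c * Q w / (m1 * (m1 - w * Q w)) - 1 @[w --> 0^'+] -->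
    (m2 - m1 ^+ 2) / m1 ^+ 2.
  apply: cvg_trans H; apply: near_eq_cvg.
  near=> w.
  have w0 : 0 < w by near: w; exact: nbhs_right_gt.
  have D0 : 0 < m1 - w * Q w by near: w; exact: (cvgr_gt _ cB).
  rewrite num_B ?den_B ?ltW//.
  have -> : B w = (m1 - w * Q w) / c by rewrite -B_Q ?ltW//; field.
  by field; rewrite cn0 m1n0 !lt0r_neq0.
have -> : (m2 - m1 ^+ 2) / m1 ^+ 2 = c * (m2 / c) / (m1 * m1) - 1.
  by field; rewrite cn0 m1n0.
apply: cvgB; last exact: cvg_cst.
apply: cvgM; first by apply: cvgM => //; exact: cvg_cst.
apply: cvgV; first by rewrite mulf_neq0.
by apply: cvgM => //; exact: cvg_cst.
Unshelve. all: by end_near. Qed.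

End ratio_asymptotics.

(** * Transfer of expectations from [S] to its law, and from [s] to [|s|] *)

Section law.
Context d (Omega : measurableType d) (R : realType).
Context (P : probability Omega R) (S : {RV P >-> R}) (mu : probability R R).
Hypothesis hS : has_law S mu.

Lemma integrable_expectation_law (f : R -> R) : measurable_fun setT f ->
  P.-integrable setT (EFin \o (fun x => f (S x))) ->
  'E_mu[f]%E = 'E_P[fun x => f (S x)]%E.
Proof.
move=> mf intf; rewrite unlock (eq_measure_integral (distribution P S)).
  by rewrite integral_distribution//; exact/measurable_EFinP.
by move=> A mA _; exact/esym/hS.
Qed.

(** Nonnegativity replaces integrability here, so the second moment can be moved to [mu]
    directly. *)
Lemma ge0_expectation_law (f : R -> R) : measurable_fun setT f ->
  (forall s, 0 <= f s) -> 'E_mu[f]%E = 'E_P[fun x => f (S x)]%E.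
Proof.
move=> mf f0; rewrite unlock (eq_measure_integral (distribution P S)).
  by rewrite ge0_integral_distribution//; exact/measurable_EFinP.
by move=> A mA _; exact/esym/hS.
Qed.

End law.

(** The two integrands differ only on the negative half-line, which is [mu]-null. *)
Lemma expectation_comp_norm (R : realType) (mu : probability R R) (f : R -> R) :
  mu `[0, +oo[%classic = 1%E -> measurable_fun setT f ->
  'E_mu[f]%E = 'E_mu[fun s => f (`|s|)%R]%E.
Proof.
move=> mu1 mf; rewrite unlock; apply: ae_eq_integral => //.
- exact/measurable_EFinP.
- apply/measurable_EFinP.
  by apply: measurableT_comp => //; exact: normr_measurable.
exists (~` `[0, +oo[%classic); split.
- by apply: measurableC; exact: measurable_itv.
- by rewrite [LHS]probability_setC// mu1 subee.
move=> s /= + s0; apply => _; rewrite ger0_norm//.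
by move: s0; rewrite in_itv/= andbT.
Qed.

(** * Consequences of a convergent right difference quotient *)

Lemma cvg_of_right_quotient (R : realType) (f : R -> R) (a b : R) :
  (f w - a) / w @[w --> 0^'+] --> b -> f w @[w --> 0^'+] --> a.
Proof.
move=> fb; have id0 : (w : R) @[w --> 0^'+] --> (0 : R).
  exact: cvg_at_right_filter.
have H : a + w * ((f w - a) / w) @[w --> 0^'+] --> a.
  rewrite -[X in _ --> X]addr0; apply: cvgD; first exact: cvg_cst.
  by have := cvgM id0 fb; rewrite mul0r; exact.
apply: cvg_trans H.
apply: near_eq_cvg; near=> w.
have w0 : 0 < w by near: w; exact: nbhs_right_gt.
by field; exact: lt0r_neq0.
Unshelve. all: by end_near. Qed.

(** The remainder divided by [w] is [(f w - a) / w - b], which tends to 0. *)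
Lemma littleo_of_right_quotient (R : realType) (f : R -> R) (a b : R) :
  (f w - a) / w @[w --> 0^'+] --> b ->
  f = (fun w => a + b * w) +o_ (0^'+) (fun w : R => w).
Proof.
move=> /cvgrPdist_le fb; apply/eqaddoP => e e0; near=> w.
have w0 : 0 < w by near: w; exact: nbhs_right_gt.
have -> : (f - (fun w => a + b * w)) w = - (b - (f w - a) / w) * w.
  transitivity (f w - (a + b * w)) => //.
  by field; exact: lt0r_neq0.
rewrite normrM normrN ler_wpM2r//.
by near: w; exact: fb.
Unshelve. all: by end_near. Qed.

(** * Assembly: moments, reduction to [|s|] under [mu], and the value at 0 *)

Theorem propositionF1 (R : realType) (sigma : R)
    (d : measure_display) (Omega : measurableType d)
    (P : probability Omega R) (S : {RV P >-> R})
    (mu : probability R R)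
    (hsigma : 0 < sigma ^+ 2)
    (hmu : mu `[0, +oo[%classic = 1%E)
    (hS : has_law S mu)
    (hm1 : (0 < 'E_P[S])%E)
    (hm2 : ('E_P[fun x => (S x ^+ 2)%R] < +oo)%E) :
  let m1 := fine ('E_P[S])%E in
  let VarS := fine ('V_P[S])%E in
  L sigma mu =
    (fun omega : R => sigma ^+ 2 / m1 + VarS / m1 ^+ 2 * omega)
      +o_ (0^'+) (fun omega : R => omega)
  /\ has_right_derivative (L sigma mu) 0 (VarS / m1 ^+ 2).
Proof.
set c := sigma ^+ 2 in hsigma *; move=> m1 VarS.
have mS2 : measurable_fun setT (fun x => S x ^+ 2) by exact: measurable_funX.
have SL2 : (S : Omega -> R) \in Lfun P 2%:E by exact: Lfun2_expectation_sqr.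
have iS : P.-integrable setT (EFin \o S).
  by apply/Lfun1_integrable; apply: Lfun_subset12 SL2; exact: fin_num_measure.
(* S is only almost surely nonnegative: |s| under mu stands in for S, so that
   the denominators are positive everywhere. *)
have mnorm : measurable_fun setT (Num.norm : R -> R) by exact: normr_measurable.
have ES2 : 'E_P[fun x => (S x ^+ 2)%R]%E = 'E_mu[fun s => (`|s| ^+ 2)%R]%E.
  rewrite -(ge0_expectation_law _ _ _ _ _ _ hS (fun s => s ^+ 2))//.
    by congr expectation; apply/funext => s; rewrite real_normK ?num_real.
  by move=> s; exact: sqr_ge0.
have NL2 : (Num.norm : R -> R) \in Lfun mu 2%:E.
  by apply: Lfun2_expectation_sqr => //; rewrite -ES2.
have iN : mu.-integrable setT (EFin \o (Num.norm : R -> R)).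
  by apply/Lfun1_integrable; apply: Lfun_subset12 NL2; exact: fin_num_measure.
have m1E : m1 = \int[mu]_s `|s|.
  rewrite /m1 -(integrable_expectation_law _ _ _ _ _ _ hS id)//.
  by rewrite (expectation_comp_norm _ _ id)// unlock.
have ES_fin : 'E_P[S]%E \is a fin_num by rewrite unlock integrable_fin_num.
(* Finiteness matters: [fine] would send an infinite mean to 0. *)
have m10 : 0 < m1.
  by rewrite /m1 fine_gt0// hm1 ltey_eq ES_fin.
have VarE : VarS = \int[mu]_s (`|s| ^+ 2) - m1 ^+ 2.
  rewrite /VarS varianceE//.
  rewrite [X in (X - _)%E](_ : _ = 'E_mu[fun s => (`|s| ^+ 2)%R]%E)//.
  rewrite fineB ?expe2 ?fineM ?fin_numM//.
    by rewrite expr2 /m1 unlock.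
  rewrite unlock; apply: integrable_fin_num => //.
  exact: Lfun2_integrable_sqr NL2.
have LE w : Lratio sigma mu w =
    \int[mu]_s (c * w / (c + w * `|s|)) /
    \int[mu]_s (w * `|s| / (c + w * `|s|)).
  have mden : measurable_fun setT (fun s : R => c + w * s).
    by apply: measurable_funD => //; exact: measurable_funM.
  rewrite /Lratio -/c.
  rewrite (expectation_comp_norm _ _ (fun s => c * w / (c + w * s)))//.
    rewrite (expectation_comp_norm _ _ (fun s => w * s / (c + w * s)))//.
      by rewrite unlock.
    by apply: measurable_fun_divr => //; exact: measurable_funM.
  by apply: measurable_fun_divr.
have q : (Lratio sigma mu w - c / m1) / w @[w --> 0^'+] --> VarS / m1 ^+ 2.
  rewrite VarE; under eq_fun do rewrite LE; rewrite m1E.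
  apply: ratio_expansion => //; last by rewrite -m1E.
  exact: Lfun2_integrable_sqr NL2.
(* [L] at 0 is a [lim], meaningful only once convergence is known; the quotient limit [q] provides
   it. *)
have L0 : L sigma mu 0 = c / m1.
  rewrite /L eqxx; apply: cvg_lim => //; exact: cvg_of_right_quotient q.
(* The filter [0^'+] excludes 0, so [L] and [Lratio] agree along it. *)
have qL : (L sigma mu w - c / m1) / w @[w --> 0^'+] --> VarS / m1 ^+ 2.
  apply: cvg_trans q; apply: near_eq_cvg; near=> w.
  by rewrite /L gt_eqF//; near: w; exact: nbhs_right_gt.
split; first exact: littleo_of_right_quotient.
rewrite /has_right_derivative L0; apply: cvg_trans qL.
by apply: near_eq_cvg; near=> w; rewrite add0r.
Unshelve. all: by end_near. Qed.
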